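(* Let $p(\cdot)$ be a variable exponent on $\mathbb{R}^d$ and let $\alpha,q$ be constants with $p(\cdot)\le\alpha\le q\le\infty$. Then the space $\left(L^{p(\cdot)},\ell^{q}\right)^{\alpha}$ coincides with its Köthe bidual.
   Context: $L^0$ is the set of (a.e.-equivalence classes of) measurable complex-valued functions on $\mathbb{R}^d$. A variable exponent is a measurable function $p(\cdot):\mathbb{R}^d\to[1,\infty]$. $\|f\|_{p(\cdot)}=\inf\{\lambda>0:\int_{\mathbb{R}^d}(|f(x)|/\lambda)^{p(x)}dx\le1\}$ (for $p(x)=\infty$: $t^\infty=0$ if $0\le t\le1$, $t^\infty=\infty$ if $t>1$); $L^{p(\cdot)}$ is the set of measurable $f$ with $\|f\|_{p(\cdot)}<\infty$; $L^{p(\cdot)}_{\rm loc}$ is the set of measurable $f$ with $f\chi_K\in L^{p(\cdot)}$ for every compact $K$. For $k\in\mathbb{Z}^d$, $r>0$, $I_k^r=\prod_{j=1}^d[rk_j,r(k_j+1))$. $\|f\|_{p(\cdot),q}=\big\|\{\|f\chi_{I_k^1}\|_{p(\cdot)}\}_{k\in\mathbb{Z}^d}\big\|_{\ell^q}$. For $\rho>0$, $St_\rho^{(\alpha)}f(x)=\rho^{-d/\alpha}f(\rho^{-1}x)$ (with $d/\infty=0$). The Fofana space is $\left(L^{p(\cdot)},\ell^{q}\right)^{\alpha}=\{f\in L^{p(\cdot)}_{\rm loc}:\|f\|_{p(\cdot),q,\alpha}<\infty\}$ with norm $\|f\|_{p(\cdot),q,\alpha}=\sup_{\rho>0}\|St_\rho^{(\alpha)}f\|_{p(\cdot),q}$.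 The Köthe dual $X'$ of a normed Köthe space $X$ is the set of $g\in L^0$ with $\|g\|_{X'}=\sup\{\int_{\mathbb{R}^d}|g(x)f(x)|dx: f\in X,\ \|f\|_X\le1\}<\infty$. The Köthe bidual $X''$ is the Köthe dual of $(X',\|\cdot\|_{X'})$, i.e. the set of $g\in L^0$ with $\|g\|_{X''}=\sup\{\int_{\mathbb{R}^d}|g(x)f(x)|dx: f\in X',\ \|f\|_{X'}\le1\}<\infty$. *)

(* Defs.v *)
From HB Require Import structures.
From mathcomp Require Import all_boot all_order all_algebra.
From mathcomp Require Import complex.
From mathcomp Require Import all_classical all_reals all_analysis measurable_realfun.

Set Implicit Arguments.
Unset Strict Implicit.
Unset Printing Implicit Defensive.

Import Order.TTheory GRing.Theory Num.Theory.
Import numFieldNormedType.Exports.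

Local Open Scope classical_set_scope.
Local Open Scope ring_scope.
Local Open Scope complex_scope.

(* Lebesgue measure on R^n, n = d.+1: the outer measure generated by countable
   covers by half-open boxes, restricted to its Caratheodory sigma-algebra
   (i.e. the Lebesgue measurable sets). *)
Section lebesgue.
Context {R : realType} {d : nat}.
Local Notation V := 'rV[R]_d.+1.

Definition box (a b : V) : set V :=
  [set x | forall i, a ord0 i <= x ord0 i < b ord0 i].

Definition vol (a b : V) : R := \prod_i (b ord0 i - a ord0 i).

Definition box_cover (A : set V) : set (nat -> V * V) :=
  [set B : nat -> V * V | (forall k i, (B k).1 ord0 i <= (B k).2 ord0 i) /\
           A `<=` \bigcup_k box (B k).1 (B k).2].

Definition lebesgue_outer (A : set V) : \bar R :=
  ereal_inf [set (\sum_(k <oo) (vol (B k).1 (B k).2)%:E)%E | B in box_cover A].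

Lemma vol_ge0 (a b : V) : (forall i, a ord0 i <= b ord0 i) -> 0 <= vol a b.
Proof. by move=> ab; apply: prodr_ge0 => i _; rewrite subr_ge0. Qed.

Lemma lebesgue_outer0 : lebesgue_outer set0 = 0%E.
Proof.
apply/eqP; rewrite eq_le; apply/andP; split.
  apply: ereal_inf_lbound; exists (fun=> (0, 0)); first by split.
  rewrite eseries0// => k _ _ /=.
  by rewrite /vol (bigD1 ord0)//= subrr mul0r.
apply: le_ereal_inf_tmp => _ [B [B0 _] <-].
by apply: nneseries_ge0 => k _ _; rewrite lee_fin vol_ge0.
Qed.

Lemma lebesgue_outer_ge0 A : (0 <= lebesgue_outer A)%E.
Proof.
apply: le_ereal_inf_tmp => _ [B [B0 _] <-].
by apply: nneseries_ge0 => k _ _; rewrite lee_fin vol_ge0.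
Qed.

Lemma le_lebesgue_outer :
  {homo lebesgue_outer : A B / A `<=` B >-> (A <= B)%E}.
Proof.
move=> A B AB; apply/ereal_inf_le_tmp => _ [C [C0 BC] <-].
by exists C => //; split=> //; exact: subset_trans BC.
Qed.

Lemma lebesgue_outer_sigma_subadditive : sigma_subadditive lebesgue_outer.
Proof.
move=> A; have [[i ioo]|] := pselect (exists i, lebesgue_outer (A i) = +oo%E).
  rewrite (eseries_pinfty _ _ ioo) ?leey// => n _.
  by rewrite -ltNye (lt_le_trans _ (lebesgue_outer_ge0 _)).
rewrite -forallNE => Aoo.
suff add2e (e : {posnum R}) : (lebesgue_outer (\bigcup_n A n) <=
    \sum_(i <oo) lebesgue_outer (A i) + e%:num%:E)%E.
  by apply/lee_addgt0Pr => _/posnumP[].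
rewrite (le_trans _ (epsilon_trick _ _ _))//; last first.
  by move=> n; exact: lebesgue_outer_ge0.
pose w (c : V * V) := (vol c.1 c.2)%:E.
pose P n (B : nat -> V * V) := box_cover (A n) B /\
  (\sum_(k <oo) w (B k) <= lebesgue_outer (A n) + (e%:num / (2 ^ n.+1)%:R)%:E)%E.
have [G PG] : {G : nat -> nat -> V * V & forall n, P n (G n)}.
  apply: (@choice _ _ P) => n; rewrite /P /lebesgue_outer.
  set S := (X in ereal_inf X); move infS : (ereal_inf S) => iS.
  case: iS infS => [r Sr|Soo|Soo].
  - have en1 : (0 < e%:num / (2 ^ n.+1)%:R)%R by [].
    have /(lb_ereal_inf_adherent en1) : ereal_inf S \is a fin_num by rewrite Sr.
    move=> [x [B cB Bx] xS].
    by exists B; split => //; rewrite /w Bx -Sr; exact/ltW.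
  - by have := Aoo n; rewrite /lebesgue_outer Soo.
  - by have := lebesgue_outer_ge0 (A n); rewrite /lebesgue_outer Soo.
have w0 i j : (0 <= w (G i j))%E by rewrite lee_fin vol_ge0//; exact: (PG i).1.1.
apply: (@le_trans _ _ (\esum_(c in [set: nat * nat]) w (G c.1 c.2))%E).
  have /card_esym/ppcard_eqP[f] := card_nat2.
  apply: ereal_inf_lbound => /=; exists (fun n => G (f n).1 (f n).2).
    split=> [k i|]; first exact: (PG (f k).1).1.1.
    move=> t [i _ /((PG i).1.2)[j _ Gt]]; exists (f^-1%FUN (i, j)) => //=.
    by rewrite invK ?inE.
  rewrite nneseries_esumT; last by move=> *; exact: w0.
  by rewrite (reindex_esum [set: nat] [set: nat * nat] f)//=.
have -> : [set: nat * nat] = [set: nat] `*`` (fun=> [set: nat]).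
  by apply/seteqP; split.
rewrite -(esum_esum (a := fun i j => w (G i j)))//.
rewrite -nneseries_esumT; last by move=> n /=; apply: esum_ge0 => j _.
apply: lee_nneseries => [n _ _ /=|n _]; first by apply: esum_ge0.
by rewrite -nneseries_esumT//; exact: (PG n).2.
Qed.

HB.instance Definition _ := isOuterMeasure.Build R V lebesgue_outer
  lebesgue_outer0 lebesgue_outer_ge0 le_lebesgue_outer
  lebesgue_outer_sigma_subadditive.

End lebesgue.

(* R^n, n = d.+1, with the sigma-algebra of Lebesgue measurable sets. *)
Notation Rn R d := (caratheodory_type (@lebesgue_outer R d)).

Section lebesgue_measure_Rn.
Context {R : realType} {d : nat}.

Definition lebesgue : set (Rn R d) -> \bar R := @lebesgue_outer R d.

Let lebesgue_sigma_additive : semi_sigma_additive lebesgue.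
Proof. exact: caratheodory_measure_sigma_additive. Qed.

HB.instance Definition _ := isMeasure.Build _ _ _ lebesgue
  lebesgue_outer0 lebesgue_outer_ge0 lebesgue_sigma_additive.

End lebesgue_measure_Rn.

Section spaces.
Context {R : realType} {d : nat}.
Local Notation V := 'rV[R]_d.+1.
Local Notation E := (Rn R d).
Implicit Types (f g : E -> R[i]) (p : E -> \bar R) (alpha q : \bar R).

(* Elements of L^0 are handled through representatives: every norm below takes
   the same value on two functions that are equal almost everywhere. *)
Definition L0 : set (E -> R[i]) :=
  [set f | measurable_fun [set: E] (fun x => complex.Re (f x)) /\
           measurable_fun [set: E] (fun x => complex.Im (f x))].

Definition variable_exponent p : Prop :=
  measurable_fun [set: E] p /\ forall x, (1 <= p x)%E.

(* t ^ s for t >= 0 and 1 <= s <= +oo *)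
Definition expow (t : R) (s : \bar R) : \bar R :=
  match s with
  | r%:E => (t `^ r)%:E
  | +oo%E => if t <= 1 then 0%E else +oo%E
  | -oo%E => 0%E
  end.

Definition pnorm p f : \bar R :=
  ereal_inf [set l%:E | l in [set l : R | 0 < l /\
    (\int[lebesgue]_x expow (Normc.normc (f x) / l) (p x) <= 1)%E]].

Definition cutoff f (A : set E) : E -> R[i] := fun x => f x * \1_A x.

Definition Lp p : set (E -> R[i]) :=
  [set f | L0 f /\ (pnorm p f < +oo)%E].

Definition Lp_loc p : set (E -> R[i]) :=
  [set f | L0 f /\ forall K : set V, compact K -> Lp p (cutoff f K)].

Definition cube (r : R) (k : 'rV[int]_d.+1) : set V :=
  [set x | forall j, r * (k ord0 j)%:~R <= x ord0 j < r * ((k ord0 j)%:~R + 1)].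

Definition lqnorm {I : choiceType} q (a : I -> \bar R) : \bar R :=
  match q with
  | r%:E => ((\esum_(k in [set: I]) (a k `^ r)) `^ r^-1)%E
  | +oo%E => ereal_sup (range a)
  | -oo%E => 0%E
  end.

Definition amalgam_norm p q f : \bar R :=
  lqnorm q (fun k : 'rV[int]_d.+1 => pnorm p (cutoff f (cube 1 k))).

(* the factor is rho ^ (- n / alpha), with n / +oo = 0 *)
Definition dilate alpha (rho : R) f : E -> R[i] := fun x =>
  (rho `^ (- (d.+1%:R * fine (alpha^-1)%E)))%:C * f (rho^-1 *: (x : V)).

Definition fofana_norm p q alpha f : \bar R :=
  ereal_sup [set amalgam_norm p q (dilate alpha rho f) | rho in [set r | 0 < r]].

Record fspace := FSpace {
  carrier : set (E -> R[i]);
  fspace_norm : (E -> R[i]) -> \bar R }.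

Definition fofana p q alpha : fspace :=
  FSpace [set f | Lp_loc p f /\ (fofana_norm p q alpha f < +oo)%E]
         (fofana_norm p q alpha).

Definition kothe_norm (X : fspace) g : \bar R :=
  ereal_sup [set (\int[lebesgue]_x (Normc.normc (g x * f x))%:E)%E |
             f in [set f | carrier X f /\ (fspace_norm X f <= 1)%E]].

Definition kothe_dual (X : fspace) : fspace :=
  FSpace [set g | L0 g /\ (kothe_norm X g < +oo)%E] (kothe_norm X).

Definition kothe_bidual (X : fspace) : fspace := kothe_dual (kothe_dual X).

(* equality of normed spaces: same elements, same norm on them *)
Definition coincide (X Y : fspace) : Prop :=
  carrier X = carrier Y /\ forall f, carrier X f -> fspace_norm X f = fspace_norm Y f.

End spaces.

(* Main.v *)
Require Import Defs.
From mathcomp Require Import all_boot all_order all_algebra.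
From mathcomp Require Import complex ring lra.
From mathcomp Require Import all_classical all_reals all_analysis measurable_realfun.

Set Implicit Arguments.
Unset Strict Implicit.
Unset Printing Implicit Defensive.

Import Order.TTheory GRing.Theory Num.Theory.
Import numFieldNormedType.Exports.

Local Open Scope classical_set_scope.
Local Open Scope ring_scope.

(** The norm of the Fofana space X is the supremum over rho > 0 of the norms
    N_rho f, the amalgam norm of the dilate of f by rho.  Every single N_rho is
    a supremum of integrals: if c < N_rho f, there is an explicit g >= 0 such
    that the integral of g |f| is at least c while the integral of g |h| is at
    most 1 as soon as N_rho h <= 1.  Since N_rho <= ||.||_X, the unit ball of X
    lies in that of N_rho, so such a g belongs to the unit ball of X' and
    ||f||_X'' >= c.  Taking the supremum over c and rho gives
    ||f||_X <= ||f||_X''.  The opposite inequality is homogeneity of the norm.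

    The norming functions come from tangent lines of convex powers.  For the
    Luxemburg norm ([modular_norming], [luxemburg_norming]), g is the derivative
    p u ^ (p - 1) of the modular at a truncation of u, and this truncation
    maximises the integral of g w among the w of no larger modular; where
    p = +oo the normalised indicator of a set on which u > 1 takes its place.
    For the l^q sum over the cubes ([mixed_norming]), the functions found on
    finitely many cubes are added with the coefficients b ^ (q - 1), the
    derivative of the l^q norm.  A change of variables ([integral_scale])
    transports g through the dilation ([dilate_norming]).

    The elements of X and X'' are then the same: a measurable function of finite
    norm is locally in L^p(.), because a compact set meets finitely many unit
    cubes ([fofana_carrierP]). *)

(** * Powers with an extended exponent *)

Section powers.
Context {R : realType}.
Implicit Types (t u w r : R) (s : \bar R).

(** The convex function [t ^ r] lies above its tangent at [u].  This inequality
    makes the derivative of a norm a norming function, both pointwise for the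
    modular and coefficientwise for the l^r sum. *)
Lemma powR_tangent r u w : 1 <= r -> 0 <= u -> 0 <= w ->
  r * u `^ (r - 1) * w <= w `^ r + (r - 1) * u `^ r.
Proof.
rewrite le_eqVlt => /predU1P[<- u0 w0|r1 u0 w0].
  by rewrite subrr powRr0 powRr1// mul0r addr0 !mul1r.
have r0 : 0 < r by apply: lt_trans r1.
have s0 : 0 < r - 1 by rewrite subr_gt0.
have := @conjugate_powR _ w (u `^ (r - 1)) r (r / (r - 1)) w0 (powR_ge0 _ _) r0.
rewrite divr_gt0// => /(_ isT); rewrite -powRrM.
have -> : (r - 1) * (r / (r - 1)) = r by rewrite mulrC divfK// gt_eqF.
have -> : r^-1 + (r / (r - 1))^-1 = 1.
  by field; rewrite !gt_eqF.
move=> /(_ erefl) /(ler_wpM2l (ltW r0)).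
rewrite [X in _ <= X -> _](_ : _ = w `^ r + (r - 1) * u `^ r); last first.
  by field; rewrite !gt_eqF.
by rewrite [w * _]mulrC mulrA.
Qed.

Lemma expow_ge0 t s : (0 <= expow t s)%E.
Proof.
by case: s => [r| |] //=; [rewrite lee_fin powR_ge0|case: ifP].
Qed.

Lemma expow0 s : (1 <= s)%E -> expow 0 s = 0%E.
Proof.
case: s => [r| |]//=; last by rewrite ler01.
by rewrite lee_fin => r1; rewrite powR0// gt_eqF// (lt_le_trans _ r1).
Qed.

Lemma le_expow t u s : (1 <= s)%E -> 0 <= t -> t <= u -> (expow t s <= expow u s)%E.
Proof.
move=> s1 t0 tu; case: s s1 => [r| |]//=.
  rewrite !lee_fin => r1; apply: ge0_ler_powR; rewrite ?nnegrE//; first lra.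
  exact: le_trans tu.
move=> _; case: ifPn => [_|]; first by case: ifP.
by rewrite -ltNge => t1; rewrite ifN// -ltNge (lt_le_trans t1 tu).
Qed.

(** Convexity of [expow ^~ s] together with its vanishing at 0. *)
Lemma expow_scale (c : R) t s : (1 <= s)%E -> 0 <= c <= 1 -> 0 <= t ->
  (expow (c * t) s <= c%:E * expow t s)%E.
Proof.
move=> s1 /andP[c0 c1] t0; case: s s1 => [r| |]//=.
  rewrite !lee_fin => r1; rewrite powRM//; apply: ler_wpM2r; first exact: powR_ge0.
  have := c0; rewrite le_eqVlt => /predU1P[<-|c0'].
    by rewrite powR0// gt_eqF//; lra.
  by rewrite -[leRHS]powRr1//; apply: ger_powR => //; rewrite c0'.
move=> _; case: (leP t 1) => [t1|t1].
  by rewrite mule0 ifT// mulr_ile1.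
case: ltgtP c0 => // [c0 _|<- _]; last by rewrite mul0r ler01 mul0e.
by rewrite gt0_muley// leey.
Qed.

Lemma measurable_expow d (T : measurableType d) (u : T -> R) (p : T -> \bar R) :
  measurable_fun [set: T] u -> measurable_fun [set: T] p ->
  (forall x, 0 <= u x) -> (forall x, 1 <= p x)%E ->
  measurable_fun [set: T] (fun x => expow (u x) (p x)).
Proof.
move=> mu mp u0 p1.
have -> : (fun x => expow (u x) (p x)) = (fun x =>
  if p x == +oo%E then (if u x <= 1 then 0%E else +oo%E)
  else if u x == 0 then 0%E else (expR (fine (p x) * ln (u x)))%:E).
  apply/funext => x; move: (p1 x); case: (p x) => [r| |]//= r1.
  rewrite /powR; case: eqP => // _.
  by rewrite gt_eqF//; move: r1; rewrite lee_fin; apply: lt_le_trans.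
apply: measurable_fun_ifT.
- by apply: measurable_fun_eqe.
- by apply: measurable_fun_ifT => //; exact: measurable_fun_ler.
- apply: measurable_fun_ifT => //; first exact: measurable_fun_eqr.
  apply/measurable_EFinP/measurableT_comp => //; apply: measurable_funM.
    exact: (measurableT_comp (fine_measurable _)).
  exact: measurableT_comp.
Qed.

End powers.
(** * Norming functions for the modular *)

Section modular_norming.
Context {R : realType} {dis : measure_display} {T : measurableType dis}.
Variable mu : {measure set T -> \bar R}.
Variable p : T -> \bar R.
Hypothesis mp : measurable_fun [set: T] p.
Hypothesis p1 : forall x, (1 <= p x)%E.
Implicit Types u w g : T -> R.

(** The condition on the zeros of [u] is what lets [g] be localised: it
    vanishes outside any set carrying [u]. *)
Definition norming u g := [/\ measurable_fun [set: T] g, forall x, 0 <= g x,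
  forall x, u x = 0 -> g x = 0, (1 <= \int[mu]_x (g x * u x)%:E)%E &
  forall w, measurable_fun [set: T] w -> (forall x, 0 <= w x) ->
    (\int[mu]_x expow (w x) (p x) <= 1)%E -> (\int[mu]_x (g x * w x)%:E <= 1)%E].

Lemma measurable_pred (b : T -> bool) :
  measurable_fun [set: T] b -> measurable [set x | b x].
Proof. by move=> mb; have := mb measurableT [set true]; rewrite setTI; apply. Qed.

(** Where the modular density of [u] is infinite. *)
Let peak u := [set x | (p x == +oo%E) && (1 < u x)].

Let measurable_peak u : measurable_fun [set: T] u -> measurable (peak u).
Proof.
move=> m_u; apply: measurable_pred; apply: measurable_and => //.
  exact: measurable_fun_eqe.
exact: measurable_fun_ltr.
Qed.

(** A function of modular at most 1 is at most 1 almost everywhere on the peak,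
    so averaging over the peak is bounded by 1 on the modular unit ball. *)
Let norming_peak u : measurable_fun [set: T] u -> (forall x, 0 <= u x) ->
  (0 < mu (peak u) < +oo)%E -> exists g, norming u g.
Proof.
move=> m_u u0 /andP[A0 Aoo]; have mA := measurable_peak m_u.
have [m m0 mE] : exists2 m : R, 0 < m & mu (peak u) = m%:E.
  exists (fine (mu (peak u))); first by rewrite fine_gt0// A0.
  by rewrite fineK// ge0_fin_numE// ltW.
pose g x : R := m^-1 * \1_(peak u) x.
have mg : measurable_fun [set: T] g by apply: measurable_funM.
have g0 x : 0 <= g x by rewrite mulr_ge0// invr_ge0 ltW.
have intg : (\int[mu]_x (g x)%:E = 1)%E.
  under eq_integral do rewrite EFinM.
  rewrite ge0_integralZl//; last 2 first.
  - by apply/measurable_EFinP.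
  - by rewrite lee_fin invr_ge0 ltW.
  by rewrite integral_indic// setIT mE -EFinM mulVf// gt_eqF.
have peakP x : x \in peak u -> p x = +oo%E /\ 1 < u x.
  by rewrite inE => /andP[/eqP].
exists g; split => //.
- move=> x ux; rewrite /g indicE; case: (boolP (x \in peak u)) => [|_]; last by rewrite mulr0.
  by move=> /peakP[_]; rewrite ux ltNge ler01.
- rewrite -intg; apply: ge0_le_integral => //.
  + by move=> x _; rewrite lee_fin.
  + exact/measurable_EFinP.
  + by apply/measurable_EFinP/measurable_funM.
  move=> x _; rewrite lee_fin /g indicE.
  case: (boolP (x \in peak u)) => [|_]; last by rewrite mulr0 mul0r.
  by move=> /peakP[_ /ltW u1]; rewrite mulr1 ler_peMr// invr_ge0 ltW.
(* On the peak [expow (w x) (p x)] is 0 or +oo, so any positive multiple of it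
   absorbs the part of [w] above 1. *)
move=> w mw w0 w1; apply/lee_addgt0Pr => e e0.
have mEw := measurable_expow mw mp w0 p1.
apply: (@le_trans _ _ (\int[mu]_x ((g x)%:E + e%:E * expow (w x) (p x)))%E).
  apply: ge0_le_integral => //.
  - by move=> x _; rewrite lee_fin mulr_ge0.
  - by apply/measurable_EFinP/measurable_funM.
  - by apply: emeasurable_funD; [exact/measurable_EFinP|exact: emeasurable_funM].
  move=> x _; have e1 : (0 <= e%:E * expow (w x) (p x))%E.
    by rewrite mule_ge0 ?expow_ge0// lee_fin ltW.
  have [xA|xA] := boolP (x \in peak u); last first.
    by rewrite {1}/g indicE (negbTE xA) mulr0 mul0r adde_ge0// lee_fin.
  have [-> /= _] := peakP _ xA; case: ifPn => [wx|].
    by rewrite mule0 adde0 lee_fin ler_piMr.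
  by rewrite gt0_muley ?lte_fin// addey// leey.
rewrite ge0_integralD//; last 4 first.
- by move=> x _; rewrite lee_fin.
- exact/measurable_EFinP.
- by move=> x _; rewrite mule_ge0 ?expow_ge0// lee_fin ltW.
- exact: emeasurable_funM.
rewrite intg leeD2l// ge0_integralZl//.
- by rewrite -[leRHS]mule1 lee_pmul2l// lte_fin.
- by move=> x _; exact: expow_ge0.
- by rewrite lee_fin ltW.
Qed.

(** On this set [u] and [p] are bounded, hence so is [p u ^ (p - 1)], and [u] is
    positive, so that a function supported there vanishes where [u] does. *)
Let trunc u n x := [&& (p x <= n%:R%:E)%E, n.+1%:R^-1 <= u x & u x <= n%:R].

Let measurable_trunc u n :
  measurable_fun [set: T] u -> measurable_fun [set: T] (trunc u n).
Proof.
move=> m_u; apply: measurable_and; first exact: measurable_fun_lee.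
by apply: measurable_and; exact: measurable_fun_ler.
Qed.

(** By monotone convergence, since the truncations exhaust the set where the
    modular density is positive, up to the null peak: where [p = +oo] and
    [u <= 1] the density is 0. *)
Let trunc_modular u : measurable_fun [set: T] u -> (forall x, 0 <= u x) ->
  mu (peak u) = 0%E -> (1 < \int[mu]_x expow (u x) (p x))%E ->
  exists n, (1 < \int[mu]_x (if trunc u n x then expow (u x) (p x) else 0))%E.
Proof.
move=> m_u u0 A0 u1; have mA := measurable_peak m_u.
have mE := measurable_expow m_u mp u0 p1.
pose F n x := if trunc u n x then expow (u x) (p x) else 0%E.
have mF n : measurable_fun [set: T] (F n).
  by apply: measurable_fun_ifT => //; exact: measurable_trunc.
have F0 n x : (0 <= F n x)%E by rewrite /F; case: ifP; rewrite ?expow_ge0.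
have ndF x : {homo F^~ x : m n / (m <= n)%N >-> (m <= n)%E}.
  move=> m n mn; rewrite {1}/F; case: ifPn => // /and3P[pm mx xm].
  rewrite /F ifT//; apply/and3P; split.
  - by rewrite (le_trans pm)// lee_fin ler_nat.
  - by rewrite (le_trans _ mx)// lef_pV2 ?posrE// ler_nat.
  - by rewrite (le_trans xm)// ler_nat.
have limF x : x \notin peak u -> limn (F^~ x) = expow (u x) (p x).
  move=> /negP xA; apply/cvg_lim => //; apply: cvg_near_cst.
  have [ux0|ux0] := eqVneq (u x) 0.
    by apply: nearW => n; rewrite /F ux0 expow0//; case: ifP.
  have {}ux0 : 0 < u x by rewrite lt_neqAle eq_sym ux0 u0.
  have := p1 x; case Ep : (p x) => [r| |]// r1; last first.
    apply: nearW => n; rewrite /F Ep /=; case: (leP (u x) 1) => ux1.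
      by case: ifP.
    by exfalso; apply: xA; rewrite inE /peak /= Ep eqxx.
  rewrite lee_fin in r1; pose M := r + u x + (u x)^-1.
  have ui0 : 0 < (u x)^-1 by rewrite invr_gt0.
  have M0 : 0 <= M by rewrite /M; lra.
  exists (Num.bound M) => // n /= Mn.
  have {Mn} Mn : M < n%:R.
    by apply: lt_le_trans (archi_boundP M0) _; rewrite ler_nat.
  rewrite /M in Mn; rewrite /F Ep ifT//; apply/and3P; split.
  - by rewrite Ep lee_fin; lra.
  - rewrite invf_ple ?posrE// -natr1; lra.
  - lra.
apply: contrapT => /forallNP Fn.
have : (\int[mu]_x limn (F^~ x) <= 1)%E.
  rewrite monotone_convergence//.
  apply: lime_le.
    by apply/cvgP/(@cvg_monotone_convergence _ _ _ mu _ measurableT F).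
  by apply: nearW => n; rewrite leNgt; apply/negP; exact: Fn.
rewrite leNgt => /negP; apply; apply: lt_le_trans u1 _.
rewrite le_eqVlt; apply/predU1P; left.
apply: ge0_ae_eq_integral => //.
- apply: (emeasurable_fun_cvg F) => // x _.
  exact: ereal_nondecreasing_is_cvgn.
- by move=> x _; exact: expow_ge0.
- move=> x _; apply: lime_ge; first exact: ereal_nondecreasing_is_cvgn.
  exact: nearW.
exists (peak u); split=> // x /=; apply: contra_notP => xA _.
by rewrite limF//; apply/negP; rewrite inE.
Qed.

(** With [g] the derivative of the modular at the truncation of [u], integrating
    the tangent inequality gives, for every [w] of modular at most 1,
    int (g w) - int (g u) <= modular w - modular (truncated u) <= 0.
    Hence [g / int (g u)] is norming. *)
Let norming_trunc u (n : nat) : measurable_fun [set: T] u -> (forall x, 0 <= u x) ->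
  (mu [set x | u x != 0%R] < +oo)%E ->
  (1 < \int[mu]_x (if trunc u n x then expow (u x) (p x) else 0))%E ->
  exists g, norming u g.
Proof.
move=> m_u u0 supp.
set F : T -> \bar R := fun x => _; set S := [set x | u x != 0] => F1.
have mtr := measurable_trunc n m_u.
have mF : measurable_fun [set: T] F.
  by apply: measurable_fun_ifT => //; exact: measurable_expow.
have F0 x : (0 <= F x)%E by rewrite /F; case: ifP; rewrite ?expow_ge0.
have mS : measurable S.
  apply: measurable_pred; apply: measurable_neg; exact: measurable_fun_eqr.
pose g x := if trunc u n x then fine (p x) * u x `^ (fine (p x) - 1) else 0.
have trP x : trunc u n x -> exists r : R,
    [/\ p x = r%:E, 1 <= r <= n%:R & 0 < u x <= n%:R].
  move=> /and3P[pn nx xn]; move: (p1 x) pn; case: (p x) => [r| |]//.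
  rewrite !lee_fin => r1 rn; exists r; split=> //; first by rewrite r1.
  by rewrite xn andbT (lt_le_trans _ nx)// invr_gt0.
have g0 x : 0 <= g x.
  rewrite /g; case: ifPn => // /trP[r [-> /andP[r1 _] _]] /=.
  by rewrite mulr_ge0 ?powR_ge0//; lra.
have mg : measurable_fun [set: T] g.
  have -> : g = fun x => if trunc u n x then
      fine (p x) * expR ((fine (p x) - 1) * ln (u x)) else 0.
    apply/funext => x; rewrite /g; case: ifPn => // /trP[r [-> _ /andP[ux _]]].
    by rewrite /powR gt_eqF.
  have mfp : measurable_fun [set: T] (fun x => fine (p x)).
    exact: (measurableT_comp (fine_measurable _)).
  apply: measurable_fun_ifT => //; apply: measurable_funM => //.
  apply: measurableT_comp => //; apply: measurable_funM; last first.
    exact: measurableT_comp.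
  exact: measurable_funB.
have mgu : measurable_fun [set: T] (fun x => (g x * u x)%:E).
  by apply/measurable_EFinP/measurable_funM.
have gu0 x : (0 <= (g x * u x)%:E)%E by rewrite lee_fin mulr_ge0.
have guE x r : trunc u n x -> p x = r%:E -> g x * u x = r * u x `^ r.
  move=> tx pr; have [_ [_ _ /andP[ux _]]] := trP _ tx.
  rewrite /g tx pr /= -mulrA; congr (_ * _).
  rewrite -[X in _ * X]powRr1 ?ltW// -powRD ?subrK//.
  by rewrite (gt_eqF ux) implybT.
have F_le x : (F x <= (g x * u x)%:E)%E.
  rewrite /F; case: ifPn => // tx; have [r [pr /andP[r1 _] _]] := trP _ tx.
  by rewrite (guE _ _ tx pr) pr lee_fin ler_peMl ?powR_ge0.
have IF : (\int[mu]_x F x <= \int[mu]_x (g x * u x)%:E)%E.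
  exact: ge0_le_integral.
have Ioo : (\int[mu]_x (g x * u x)%:E < +oo)%E.
  pose C : R := n%:R * (n.+1%:R `^ n%:R).
  apply: (@le_lt_trans _ _ (\int[mu]_x (C%:E * (\1_S x)%:E))%E).
    apply: ge0_le_integral => //.
      by apply: emeasurable_funM => //; exact/measurable_EFinP.
    move=> x _; rewrite -EFinM lee_fin indicE.
    have [tx|ntx] := boolP (trunc u n x); last first.
      by rewrite /g (negbTE ntx) mul0r !mulr_ge0// powR_ge0.
    have [r [pr /andP[r1 rn] /andP[ux xn]]] := trP _ tx.
    rewrite (guE _ _ tx pr) mem_set ?mulr1; last by rewrite /S /= gt_eqF.
    apply: ler_pM => //; [lra|exact: powR_ge0|].
    apply: (@le_trans _ _ (n.+1%:R `^ r)).
      apply: ge0_ler_powR; rewrite ?nnegrE// ?(ltW ux)//; first lra.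
      by rewrite -natr1; lra.
    by apply: ler_powR => //; rewrite ler1n.
  rewrite ge0_integralZl//; last 2 first.
    exact/measurable_EFinP.
    by rewrite lee_fin mulr_ge0// powR_ge0.
  by rewrite integral_indic// setIT lte_mul_pinfty// lee_fin mulr_ge0// powR_ge0.
have [I I1 IE] : exists2 I : R, 1 < I & (\int[mu]_x (g x * u x)%:E = I%:E)%E.
  exists (fine (\int[mu]_x (g x * u x)%:E)).
    rewrite -lte_fin fineK; first exact: lt_le_trans IF.
    by rewrite ge0_fin_numE// integral_ge0.
  by rewrite fineK// ge0_fin_numE// integral_ge0.
have I0 : 0 < I by lra.
exists (fun x => I^-1 * g x); split.
- exact: measurable_funM.
- by move=> x; rewrite mulr_ge0// invr_ge0 ltW.
- move=> x ux; rewrite /g; case: ifPn; rewrite ?mulr0// => /trP[r [_ _]].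
  by rewrite ux ltxx.
- under eq_integral do rewrite -mulrA EFinM.
  rewrite ge0_integralZl//; last by rewrite lee_fin invr_ge0 ltW.
  by rewrite IE -EFinM mulVf ?gt_eqF.
move=> w mw w0 w1.
have mgw : measurable_fun [set: T] (fun x => (g x * w x)%:E).
  by apply/measurable_EFinP/measurable_funM.
have gw0 x : (0 <= (g x * w x)%:E)%E by rewrite lee_fin mulr_ge0.
under eq_integral do rewrite -mulrA EFinM.
rewrite ge0_integralZl//; last by rewrite lee_fin invr_ge0 ltW.
suff : (\int[mu]_x (g x * w x)%:E <= I%:E)%E.
  move=> /(lee_wpmul2l (x := I^-1%:E)); rewrite lee_fin invr_ge0 (ltW I0).
  by move=> /(_ isT)/le_trans; apply; rewrite -EFinM mulVf// gt_eqF.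
have : (\int[mu]_x ((g x * w x)%:E + F x) <=
        \int[mu]_x (expow (w x) (p x) + (g x * u x)%:E))%E.
  apply: ge0_le_integral => //.
  - by move=> x _; rewrite adde_ge0.
  - exact: emeasurable_funD.
  - by apply: emeasurable_funD => //; exact: measurable_expow.
  move=> x _; rewrite {1}/g /F; case: ifPn => tx; last first.
    by rewrite mul0r adde0 adde_ge0// expow_ge0.
  have [r [pr /andP[r1 _] /andP[ux _]]] := trP _ tx.
  rewrite (guE _ _ tx pr) pr /= -!EFinD lee_fin.
  have := powR_tangent r1 (ltW ux) (w0 x); rewrite mulrBl mul1r; lra.
rewrite !ge0_integralD//; last 2 first.
- by move=> x _; exact: expow_ge0.
- exact: measurable_expow.
rewrite IE => H.
have : (\int[mu]_x (g x * w x)%:E + 1 <= 1 + I%:E)%E.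
  apply: le_trans (le_trans H _); first by rewrite leeD2l// ltW.
  by rewrite leeD2r.
by rewrite [leRHS]addeC leeD2rE.
Qed.

Lemma modular_norming u : measurable_fun [set: T] u -> (forall x, 0 <= u x) ->
  (mu [set x | u x != 0%R] < +oo)%E -> (1 < \int[mu]_x expow (u x) (p x))%E ->
  exists g, norming u g.
Proof.
move=> m_u u0 supp u1; have mA := measurable_peak m_u.
have [A0|A0] := eqVneq (mu (peak u)) 0%E.
  by have [n] := trunc_modular m_u u0 A0 u1; exact: norming_trunc.
apply: norming_peak => //; rewrite lt_neqAle eq_sym A0 measure_ge0/=.
apply: le_lt_trans supp; apply: le_measure; rewrite ?inE//.
  apply: measurable_pred; apply: measurable_neg; exact: measurable_fun_eqr.
by move=> x /andP[_ ux]; rewrite /= gt_eqF// (lt_trans ltr01).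
Qed.

End modular_norming.

(** * Boxes, open sets and dilations for Lebesgue measure *)

Section lebesgue_geometry.
Context {R : realType} {d : nat}.
Local Notation V := 'rV[R]_d.+1.
Local Notation E := (Rn R d).
Local Notation outer := (@lebesgue_outer R d).
Implicit Types (a b x : V) (A : set V) (i : 'I_d.+1) (c r : R).

Let upd a i c : V := \row_j (if j == i then c else a ord0 j).

Let vol_split a b i c :
  vol a (upd b i c) + vol (upd a i c) b = vol a b.
Proof.
have volE a' b' : (forall j, j != i -> b' ord0 j - a' ord0 j = b ord0 j - a ord0 j) ->
    vol a' b' = (b' ord0 i - a' ord0 i) * \prod_(j | j != i) (b ord0 j - a ord0 j).
  by move=> ab; rewrite /vol (bigD1 i)//=; congr (_ * _); exact: eq_bigr.
rewrite !volE ?mxE ?eqxx//; last 2 first.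
- by move=> j /negbTE ji; rewrite mxE ji.
- by move=> j /negbTE ji; rewrite mxE ji.
by rewrite -mulrDl; congr (_ * _); lra.
Qed.

(** A hyperplane orthogonal to an axis cuts every box of a cover into two boxes
    whose volumes add up. *)
Lemma measurable_halfspace i c : measurable ([set x : V | x ord0 i < c] : set E).
Proof.
apply: le_caratheodory_measurable => X; apply: le_ereal_inf_tmp => _ [B [B0 BX] <-].
set H : set V := [set x | _].
(* The cut is clamped to the side of the box, so that both halves have
   nonnegative sides even when the hyperplane misses the box. *)
pose m k := Num.max ((B k).1 ord0 i) (Num.min ((B k).2 ord0 i) c).
have m1 k : (B k).1 ord0 i <= m k <= (B k).2 ord0 i.
  by rewrite /m le_max lexx /= ge_max B0 ge_min lexx.
pose B1 k := ((B k).1, upd (B k).2 i (m k)).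
pose B2 k := (upd (B k).1 i (m k), (B k).2).
have B10 k j : (B1 k).1 ord0 j <= (B1 k).2 ord0 j.
  rewrite mxE; case: eqP => [->|_]; last exact: B0.
  by have /andP[] := m1 k.
have B20 k j : (B2 k).1 ord0 j <= (B2 k).2 ord0 j.
  rewrite mxE; case: eqP => [->|_]; last exact: B0.
  by have /andP[] := m1 k.
have cov1 : box_cover (X `&` H) B1.
  split=> // x [/BX[k _ xk] xc]; exists k => // j; have := xk j.
  rewrite mxE; case: eqP => [->|//] /andP[-> xb] /=.
  by rewrite /m lt_max lt_min xb xc orbT.
have cov2 : box_cover (X `&` ~` H) B2.
  split=> // x [/BX[k _ xk] /negP]; rewrite -leNgt => cx; exists k => // j.
  have := xk j; rewrite mxE; case: eqP => [->|//] /andP[xa ->].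
  by rewrite andbT /m ge_max xa ge_min cx orbT.
apply: (@le_trans _ _ (\sum_(k <oo) (vol (B1 k).1 (B1 k).2)%:E +
                       \sum_(k <oo) (vol (B2 k).1 (B2 k).2)%:E)%E).
  by apply: leeD; apply: ereal_inf_lbound; [exists B1|exists B2].
rewrite -nneseriesD; last 2 first.
- by move=> k _ _; rewrite lee_fin vol_ge0.
- by move=> k _ _; rewrite lee_fin vol_ge0.
rewrite (@eq_eseriesr _ _ (fun k => (vol (B k).1 (B k).2)%:E))// => k _ /=.
by rewrite -EFinD vol_split.
Qed.

Lemma measurable_box a b : measurable (box a b : set E).
Proof.
have -> : box a b = \bigcap_(i in [set: 'I_d.+1])
    ([set x : V | x ord0 i < b ord0 i] `\` [set x : V | x ord0 i < a ord0 i]).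
  apply/seteqP; split=> x abx i; first move=> _.
    by have /andP[ax xb] := abx i; split => //=; apply/negP; rewrite -leNgt.
  by have [xb /negP] := abx i Logic.I; rewrite -leNgt xb andbT.
apply: (@fin_bigcap_measurable _ E) => [|i _]; first exact: finite_finset.
by apply: measurableD; exact: measurable_halfspace.
Qed.

Lemma lebesgue_box_lty a b : (forall i, a ord0 i <= b ord0 i) ->
  (lebesgue (box a b : set E) < +oo)%E.
Proof.
move=> ab; apply: (@le_lt_trans _ _ (vol a b)%:E); last exact: ltry.
apply: ereal_inf_lbound; exists (fun k => if k is 0%N return (V * V)%type then (a, b) else (0, 0)).
  split=> [[|k] i //|x abx]; by exists 0%N.
rewrite (@nneseriesD1 _ _ 0%N)//=; last first.
  move=> [|k] _ /=; rewrite lee_fin; first exact: vol_ge0.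
  by rewrite /vol prodr_ge0// => i _; rewrite subrr.
rewrite eseries0 ?adde0// => -[|k] _ //= _.
by rewrite /vol (bigD1 ord0)//= subrr mul0r.
Qed.

(** An open set is the union of the countably many boxes with rational corners
    that it contains. *)
Lemma measurable_open A : open A -> measurable (A : set E).
Proof.
move=> oA; pose rvec (v : 'rV[rat]_d.+1) : V := \row_j ratr (v ord0 j).
pose F n : set V := if @unpickle ('rV[rat]_d.+1 * 'rV[rat]_d.+1)%type n is Some v
  then [set x | box (rvec v.1) (rvec v.2) x /\ box (rvec v.1) (rvec v.2) `<=` A]
  else set0.
have -> : A = \bigcup_n F n.
  apply/seteqP; split=> [x Ax|x [n _]]; last first.
    by rewrite /F; case: unpickle => // v [vx]; exact.
  have /nbhs_ballP[e /= e0 eA] : nbhs x A by exact: open_nbhs_nbhs.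
  have /choice[a aP] : forall j, exists q : rat, x ord0 j - e < ratr q < x ord0 j.
    move=> j; have [|q] := @rat_in_itvoo R (x ord0 j - e) (x ord0 j); first lra.
    by rewrite in_itv /=; exists q.
  have /choice[b bP] : forall j, exists q : rat, x ord0 j < ratr q < x ord0 j + e.
    move=> j; have [|q] := @rat_in_itvoo R (x ord0 j) (x ord0 j + e); first lra.
    by rewrite in_itv /=; exists q.
  exists (pickle (\row_j a j, \row_j b j)) => //; rewrite /F pickleK /=; split.
    by move=> j; rewrite !mxE; have := aP j; have := bP j; lra.
  move=> y abxy; apply: eA; split=> // i j; rewrite ord1.
  have := abxy j; rewrite !mxE /ball /= ltr_distl.
  by have := aP j; have := bP j; lra.
apply: (@bigcupT_measurable _ E) => n; rewrite /F.
case: unpickle => [v|]; last exact: measurable0.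
have [vA|vA] := pselect (box (rvec v.1) (rvec v.2) `<=` A).
  rewrite (_ : [set x | _] = box (rvec v.1) (rvec v.2)); first exact: measurable_box.
  by apply/seteqP; split=> [x []|x ?].
rewrite (_ : [set x | _] = set0); first exact: measurable0.
by apply/seteqP; split=> x // [].
Qed.

Lemma measurable_compact A : compact A -> measurable (A : set E).
Proof.
move=> cA; rewrite -[A]setCK; apply: (@measurableC _ E).
apply: measurable_open; apply: closed_openC; apply: compact_closed cA.
exact: norm_hausdorff.
Qed.

Let outer_scale_le r A : 0 < r ->
  ((r ^+ d.+1)%:E * outer [set x : V | A (r *: x)] <= outer A)%E.
Proof.
move=> r0; apply: le_ereal_inf_tmp => _ [B [B0 BA] <-].
have rn0 : 0 < r ^+ d.+1 by rewrite exprn_gt0.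
pose B' k := (r^-1 *: (B k).1, r^-1 *: (B k).2).
have covB' : box_cover [set x : V | A (r *: x)] B'.
  split=> [k i|x /BA[k _ xk]].
    by rewrite !mxE ler_pM2l ?invr_gt0.
  exists k => // i; have := xk i; rewrite !mxE.
  by rewrite ler_pdivrMl// ltr_pdivlMl.
have volE k : ((vol (B k).1 (B k).2)%:E =
    (r ^+ d.+1)%:E * (vol (B' k).1 (B' k).2)%:E)%E.
  have -> : r ^+ d.+1 = \prod_(i < d.+1) r by rewrite prodr_const card_ord.
  rewrite -EFinM /vol -big_split /=.
  congr (_%:E); apply: eq_bigr => i _; rewrite !mxE -mulrBr mulrA divff ?mul1r//.
  by rewrite gt_eqF.
rewrite (eq_eseriesr (fun k _ => volE k)) nneseriesZl; last first.
  by move=> k _; rewrite lee_fin vol_ge0// => i; have [+ _] := covB'; exact.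
apply: lee_wpmul2l; first by rewrite lee_fin ltW.
by apply: ereal_inf_lbound; exists B'.
Qed.

(** Each inequality is [outer_scale_le], applied to [r] and to [r^-1]. *)
Lemma lebesgue_outer_scale r A : 0 < r ->
  outer [set x : V | A (r *: x)] = ((r ^- d.+1)%:E * outer A)%E.
Proof.
move=> r0; have rn0 : 0 < r ^+ d.+1 by rewrite exprn_gt0.
apply/eqP; rewrite eq_le; apply/andP; split.
  have := outer_scale_le A r0.
  move=> /(lee_wpmul2l (x := (r ^- d.+1)%:E)); rewrite lee_fin invr_ge0 ltW//.
  by move=> /(_ isT); rewrite muleA -EFinM mulVf ?gt_eqF// mul1e.
have ri0 : 0 < r^-1 by rewrite invr_gt0.
have := outer_scale_le [set x | A (r *: x)] ri0.
rewrite exprVn; congr (_ * outer _ <= _)%E.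
by apply/seteqP; split=> x /=; rewrite scalerA divff ?gt_eqF// scale1r.
Qed.

Lemma measurable_scale r : 0 < r ->
  measurable_fun [set: E] (fun x : E => (r *: (x : V)) : E).
Proof.
move=> r0 _ A mA; rewrite setTI.
have {}mA : caratheodory_measurable outer A := mA.
change (caratheodory_measurable outer [set x : V | A (r *: x)]) => X.
have XE : X = [set x : V | [set y : V | X (r^-1 *: y)] (r *: x)].
  by apply/seteqP; split=> x /=; rewrite scalerA mulVf ?gt_eqF// scale1r.
set Y : set V := [set y | X (r^-1 *: y)] in XE.
have rn0 : 0 <= r ^- d.+1 by rewrite invr_ge0 exprn_ge0// ltW.
rewrite [in LHS]XE lebesgue_outer_scale// (mA Y).
rewrite ge0_muleDr ?lebesgue_outer_ge0//.
rewrite -!lebesgue_outer_scale//; congr (outer _ + outer _)%E.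
  by rewrite [in RHS]XE.
by rewrite [in RHS]XE.
Qed.

(** Change of variables for a dilation: the image of Lebesgue measure is a
    multiple of it. *)
Lemma integral_scale r (F : E -> \bar R) : 0 < r ->
  measurable_fun [set: E] F -> (forall x, 0 <= F x)%E ->
  (\int[lebesgue]_x F (r *: (x : V)) = (r ^- d.+1)%:E * \int[lebesgue]_x F x)%E.
Proof.
move=> r0 mF F0; have ms := measurable_scale r0.
have rn0 : 0 <= r ^- d.+1 by rewrite invr_ge0 exprn_ge0// ltW.
have := @ge0_integral_pushforward _ _ _ _ R _ ms lebesgue setT F measurableT mF.
rewrite preimage_setT => <-; last by move=> x _; exact: F0.
rewrite (eq_measure_integral (mscale (NngNum rn0) lebesgue)); last first.
  by move=> A mA _; rewrite /mscale /pushforward /=; exact: lebesgue_outer_scale.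
by rewrite ge0_integral_mscale.
Qed.

End lebesgue_geometry.

(** * The Luxemburg norm *)

Section luxemburg.
Context {R : realType} {dis : measure_display} {T : measurableType dis}.
Variable mu : {measure set T -> \bar R}.
Variable p : T -> \bar R.
Hypothesis mp : measurable_fun [set: T] p.
Hypothesis p1 : forall x, (1 <= p x)%E.
Implicit Types (u w g : T -> R) (A B Q : set T).

(** The norm is taken on nonnegative real functions over an arbitrary measure
    space; complex values and Lebesgue measure enter only through the moduli of
    functions, at the very end. *)
Definition luxemburg u : \bar R :=
  ereal_inf [set l%:E | l in [set l : R | 0 < l /\
    (\int[mu]_x expow (u x / l) (p x) <= 1)%E]].

Definition nonneg_measurable u := measurable_fun [set: T] u /\ forall x, 0 <= u x.

Lemma nonneg_measurableM u w :
  nonneg_measurable u -> nonneg_measurable w -> nonneg_measurable (u \* w).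
Proof.
move=> [m_u u0] [mw w0]; split; first exact: measurable_funM.
by move=> x; exact: mulr_ge0.
Qed.

Lemma nonneg_measurable_cst (c : R) : 0 <= c -> nonneg_measurable (cst c).
Proof. by move=> c0; split => // x; exact: c0. Qed.

Lemma nonneg_measurable_indic A : measurable A -> nonneg_measurable \1_A.
Proof. by move=> mA; split => // x; rewrite indicE. Qed.

Lemma nonneg_measurableZ (c : R) u : 0 <= c ->
  nonneg_measurable u -> nonneg_measurable (fun x => c * u x).
Proof.
by move=> c0; apply: nonneg_measurableM; exact: nonneg_measurable_cst.
Qed.

Lemma measurable_EFin_fun u : nonneg_measurable u ->
  measurable_fun [set: T] (fun x => (u x)%:E).
Proof. by case=> m_u _; exact/measurable_EFinP. Qed.

Lemma integralM_scale g u (c : R) : 0 <= c ->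
  nonneg_measurable g -> nonneg_measurable u ->
  (\int[mu]_x (g x * (c * u x))%:E = c%:E * \int[mu]_x (g x * u x)%:E)%E.
Proof.
move=> c0 mg m_u; have gu := nonneg_measurableM mg m_u.
under eq_integral do rewrite mulrCA EFinM.
rewrite ge0_integralZl//; first exact: measurable_EFin_fun gu.
by move=> x _; rewrite lee_fin; case: gu => _; exact.
Qed.

Lemma measurable_modular u (l : R) : nonneg_measurable u -> 0 < l ->
  measurable_fun [set: T] (fun x => expow (u x / l) (p x)).
Proof.
move=> [m_u u0] l0; apply: measurable_expow => //.
  exact: measurable_funM.
by move=> x; rewrite divr_ge0// ltW.
Qed.

Lemma luxemburg_ge0 u : (0 <= luxemburg u)%E.
Proof.
by apply: le_ereal_inf_tmp => _ [l [l0 _] <-]; rewrite lee_fin ltW.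
Qed.

Lemma luxemburg_le u (l : R) : 0 < l ->
  (\int[mu]_x expow (u x / l) (p x) <= 1)%E -> (luxemburg u <= l%:E)%E.
Proof. by move=> l0 ul; apply: ereal_inf_lbound; exists l. Qed.

Let luxemburgZ_le (c : R) u : 0 < c ->
  (luxemburg (fun x => (c * u x)%R) <= c%:E * luxemburg u)%E.
Proof.
move=> c0; rewrite muleC -lee_pdivrMr//; apply: le_ereal_inf_tmp => _ [l [l0 ul] <-].
rewrite lee_pdivrMr// -EFinM; apply: luxemburg_le; first exact: mulr_gt0.
apply: le_trans ul; rewrite le_eqVlt; apply/predU1P; left.
by apply: eq_integral => x _; congr expow; field; rewrite !gt_eqF.
Qed.

Lemma luxemburgZ (c : R) u : 0 < c ->
  luxemburg (fun x => c * u x) = (c%:E * luxemburg u)%E.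
Proof.
move=> c0; apply/eqP; rewrite eq_le luxemburgZ_le//=.
have ci0 : 0 < c^-1 by rewrite invr_gt0.
have := luxemburgZ_le (fun x => c * u x) ci0.
have -> : (fun x => c^-1 * (c * u x)) = u.
  by apply/funext => x; rewrite mulKf ?gt_eqF.
by rewrite lee_pdivlMl.
Qed.

Lemma le_luxemburg u w : nonneg_measurable u -> nonneg_measurable w ->
  (forall x, u x <= w x) -> (luxemburg u <= luxemburg w)%E.
Proof.
move=> m_u mw uw; apply: le_ereal_inf_tmp => _ [l [l0 wl] <-].
apply: luxemburg_le => //; apply: le_trans wl; apply: ge0_le_integral => //.
- by move=> x _; exact: expow_ge0.
- exact: measurable_modular.
- exact: measurable_modular.
move=> x _; apply: le_expow => //; case: m_u => _ u0.
  by rewrite divr_ge0// ltW.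
by rewrite ler_pM2r ?invr_gt0.
Qed.

(** If [u / a] and [w / b] have modular at most 1, then by convexity [u / l] and
    [w / l] have modular at most 1/2 for [l = 2 (a + b)], and the modular of the
    maximum is at most the sum. *)
Lemma luxemburg_max_lty u w : nonneg_measurable u -> nonneg_measurable w ->
  (luxemburg u < +oo)%E -> (luxemburg w < +oo)%E ->
  (luxemburg (fun x => Num.max (u x) (w x)) < +oo)%E.
Proof.
move=> m_u mw /ereal_inf_lt[_ [a [a0 ua] <-] _] /ereal_inf_lt[_ [b [b0 wb] <-] _].
have mm : nonneg_measurable (fun x => Num.max (u x) (w x)).
  split; first by apply: measurable_maxr; [have [] := m_u|have [] := mw].
  by move=> x; rewrite le_max; case: m_u => _ ->.
pose l := 2 * (a + b); have l0 : 0 < l by rewrite /l; lra.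
apply: (@le_lt_trans _ _ l%:E); last exact: ltry.
have half0 v (c : R) x : (0 <= (2^-1 : R)%:E * expow (v x / c) (p x))%E.
  by rewrite mule_ge0 ?expow_ge0// lee_fin.
have mhalf v (c : R) : nonneg_measurable v -> 0 < c ->
    measurable_fun [set: T] (fun x => (2^-1 : R)%:E * expow (v x / c) (p x))%E.
  by move=> mv c0; apply: emeasurable_funM => //; exact: measurable_modular.
have half v (c : R) : nonneg_measurable v -> 0 < c <= a + b -> forall x,
    (expow (v x / l) (p x) <= (2^-1 : R)%:E * expow (v x / c) (p x))%E.
  move=> [_ v0] /andP[c0 cab] x.
  have vc0 : 0 <= v x / c by rewrite divr_ge0// ltW.
  have h01 : 0 <= (2^-1 : R) <= 1 by apply/andP; split; lra.
  apply: le_trans (expow_scale (p1 x) h01 vc0).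
  apply: le_expow => //; first by rewrite divr_ge0// ltW.
  rewrite mulrCA ler_wpM2l// -invfM lef_pV2 ?posrE ?mulr_gt0 ?addr_gt0//.
  by rewrite /l ler_pM2l.
apply: luxemburg_le => //.
apply: (@le_trans _ _ (\int[mu]_x
   ((2^-1 : R)%:E * expow (u x / a) (p x) + (2^-1 : R)%:E * expow (w x / b) (p x)))%E).
  apply: ge0_le_integral => //.
  - by move=> x _; exact: expow_ge0.
  - exact: measurable_modular.
  - by apply: emeasurable_funD; exact: mhalf.
  move=> x _; rewrite maxEle; case: ifP => _.
  - apply: le_trans (half w b mw _ x) _; first by apply/andP; split; lra.
    by rewrite leeDr.
  - apply: le_trans (half u a m_u _ x) _; first by apply/andP; split; lra.
    by rewrite leeDl.
rewrite ge0_integralD//; [|exact: mhalf|exact: mhalf].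
rewrite !ge0_integralZl//; try (by move=> x _; exact: expow_ge0);
  try exact: measurable_modular.
apply: (@le_trans _ _ ((2^-1 : R)%:E * 1 + (2^-1 : R)%:E * 1)%E).
  by apply: leeD; apply: lee_wpmul2l.
by rewrite -!EFinM -EFinD lee_fin; lra.
Qed.

(** On a set covered by finitely many pieces, a function is at most the maximum
    of its restrictions to the pieces. *)
Lemma luxemburg_cover (I : eqType) (Q : I -> set T) u (K : set T) (s : seq I) :
  (forall k, measurable (Q k)) -> nonneg_measurable u -> measurable K ->
  (forall x, K x -> exists2 k, k \in s & Q k x) ->
  (forall k, luxemburg (\1_(Q k) \* u)%R < +oo)%E ->
  (luxemburg (\1_K \* u)%R < +oo)%E.
Proof.
move=> mQ m_u mK sK Qoo.
have mpiece A : measurable A -> nonneg_measurable (\1_A \* u).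
  by move=> mA; apply: nonneg_measurableM => //; exact: nonneg_measurable_indic.
pose W t x := foldr (fun k m => Num.max ((\1_(Q k) \* u) x) m) 0 t.
have WP t : nonneg_measurable (W t) /\ (luxemburg (W t) < +oo)%E.
  elim: t => [|k t [[mW W0] Woo]] /=.
    split; first exact: nonneg_measurable_cst.
    apply: (@le_lt_trans _ _ 1%:E); last exact: ltry.
    apply: luxemburg_le => //; under eq_integral => x _ do rewrite mul0r expow0//.
    by rewrite integral0.
  have [mk k0] := mpiece _ (mQ k); split; last exact: luxemburg_max_lty.
  by split; [exact: measurable_maxr|move=> x; rewrite le_max W0 orbT].
have [mW Woo] := WP s.
apply: le_lt_trans Woo; apply: le_luxemburg => //; first exact: mpiece.
move=> x /=; rewrite indicE; have [|xK] := boolP (x \in K); last first.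
  by rewrite mul0r; case: mW => _; exact.
rewrite inE mul1r => /sK[k ks Qx]; rewrite /W.
elim: s ks {sK mW} => //= j t IH; rewrite inE le_max => /predU1P[<-|/IH ->].
  by rewrite indicE mem_set// mul1r lexx.
by rewrite orbT.
Qed.

(** The modular of the restriction of [u / b] to [Q] exceeds 1, so it has a
    norming function.  That function vanishes off [Q], which localises the bound
    on [w]; dividing [w] by an admissible [l] turns it into a bound by the norm
    of [w] on [Q]. *)
Lemma luxemburg_norming u Q (b : R) : nonneg_measurable u -> measurable Q ->
  (mu Q < +oo)%E -> 0 < b -> (b%:E < luxemburg (\1_Q \* u)%R)%E ->
  exists g, [/\ nonneg_measurable g, (b%:E <= \int[mu]_x (g x * u x)%:E)%E &
    forall w, nonneg_measurable w ->
      (\int[mu]_x (g x * w x)%:E <= luxemburg (\1_Q \* w)%R)%E].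
Proof.
move=> m_u mQ Qoo b0 bu; have mI := nonneg_measurable_indic mQ.
have bi0 : 0 < b^-1 by rewrite invr_gt0.
pose v x := b^-1 * (\1_Q x * u x).
have [mv v0] : nonneg_measurable v.
  by apply: nonneg_measurableZ; [exact: ltW|exact: nonneg_measurableM].
have vQ x : x \notin Q -> v x = 0.
  by move=> xQ; rewrite /v indicE (negbTE xQ) mul0r mulr0.
have supp : (mu [set x | v x != 0%R] < +oo)%E.
  apply: le_lt_trans Qoo; apply: le_measure; rewrite ?inE//.
    apply: measurable_pred; apply: measurable_neg; exact: measurable_fun_eqr.
  by move=> x /=; apply: contra_neqP => xQ; apply: vQ; rewrite notin_setE.
have v1 : (1 < \int[mu]_x expow (v x) (p x))%E.
  rewrite ltNge; apply/negP; rewrite /v.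
  under eq_integral => x _ do rewrite mulrC.
  by move=> /(luxemburg_le b0); rewrite leNgt bu.
have [g [mg g0 gv gv1 gw]] := modular_norming mp p1 mv v0 supp v1.
have gE w x : g x * w x = g x * (\1_Q x * w x).
  rewrite indicE; have [xQ|xQ] := boolP (x \in Q); first by rewrite mul1r.
  by rewrite gv ?vQ// !mul0r.
have mg' : nonneg_measurable g by [].
exists g; split => //.
  under eq_integral => x _ do rewrite gE.
  move: gv1; rewrite (integralM_scale (ltW bi0) mg' (nonneg_measurableM mI m_u)).
  by rewrite lee_pdivlMl// mule1.
move=> w mw; apply: le_ereal_inf_tmp => _ [l [l0 wl] <-].
under eq_integral => x _ do rewrite gE.
have mIw := nonneg_measurableM mI mw.
have li0 : 0 < l^-1 by rewrite invr_gt0.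
have [mlw lw0] := nonneg_measurableZ (ltW li0) mIw.
have := gw _ mlw lw0; rewrite (integralM_scale (ltW li0) mg' mIw).
rewrite lee_pdivrMl// mule1; apply.
by under eq_integral => x _ do rewrite mulrC.
Qed.

End luxemburg.

(** * The l^q norm of an extended nonnegative family *)

Section lq.
Context {R : realType} {I : choiceType}.
Implicit Types (a : I -> \bar R) (q : \bar R).

Lemma lqnormZ (c : R) q a : (1 <= q)%E -> 0 < c -> (forall k, 0 <= a k)%E ->
  lqnorm q (fun k => c%:E * a k)%E = (c%:E * lqnorm q a)%E.
Proof.
move=> q1 c0 a0; case: q q1 => [r| |]//=; last first.
  move=> _; rewrite -ereal_sup_pZl//; congr ereal_sup.
  by rewrite image_comp.
rewrite lee_fin => r1; have r0 : r != 0 by rewrite gt_eqF//; lra.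
have -> : (\esum_(k in [set: I]) ((c%:E * a k) `^ r) =
  (c `^ r)%:E * \esum_(k in [set: I]) (a k `^ r))%E.
  rewrite /esum -ereal_sup_pZl ?powR_gt0//; congr ereal_sup.
  rewrite image_comp; apply: eq_imagel => F _ /=.
  rewrite ge0_mule_fsumr; last by move=> k; exact: poweR_ge0.
  by apply: eq_fsbigr => k _; rewrite poweRM// ?lee_fin ?ltW.
rewrite poweRM ?lee_fin ?powR_ge0//; last first.
  by apply: esum_ge0 => k _; exact: poweR_ge0.
by rewrite poweR_EFin -powRrM divff// powRr1 ?ltW.
Qed.

Lemma lqnorm_le1 (r : R) a : 1 <= r ->
  ((lqnorm r%:E a <= 1)%E <-> (\esum_(k in [set: I]) (a k `^ r) <= 1)%E).
Proof.
move=> r1 /=; set s := esum _ _.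
have s0 : (0 <= s)%E by apply: esum_ge0 => k _; exact: poweR_ge0.
have r0 : 0 < r by lra.
have mono (x y : \bar R) (t : R) : 0 <= t -> (0 <= x)%E -> (0 <= y)%E -> (x <= y)%E ->
    (x `^ t <= y `^ t)%E.
  by move=> t0 x0 y0; apply: gt0_ler_poweR; rewrite ?in_itv/= ?andbT ?x0 ?y0 ?leey.
split=> [|s1].
  move=> /(mono _ _ r (ltW r0) (poweR_ge0 _ _) lee01).
  by rewrite poweR1r -poweRrM mulVf ?gt_eqF// poweRe1.
by rewrite -[leRHS](poweR1r r^-1) mono// invr_ge0 ltW.
Qed.

Lemma le_lqnorm q a k : (1 <= q)%E -> (forall k, 0 <= a k)%E ->
  (a k <= lqnorm q a)%E.
Proof.
move=> q1 a0; case: q q1 => [r| |]//=; last first.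
  by move=> _; apply: ereal_sup_ubound; exists k.
rewrite lee_fin => r1; have r0 : 0 < r by lra.
rewrite -[leLHS]poweRe1// -[in leLHS](@divff _ r) ?gt_eqF// poweRrM.
apply: gt0_ler_poweR; first by rewrite invr_ge0 ltW.
- by rewrite in_itv/= leey poweR_ge0.
- by rewrite in_itv/= leey esum_ge0// => i _; exact: poweR_ge0.
apply: esum_ge; exists [set k]; first by split.
by rewrite fsbig_set1.
Qed.

End lq.

(** * Norming functions for the l^q sum of local Luxemburg norms *)

Section mixed.
Context {R : realType} {dis : measure_display} {T : measurableType dis}.
Variable mu : {measure set T -> \bar R}.
Variable p : T -> \bar R.
Hypothesis mp : measurable_fun [set: T] p.
Hypothesis p1 : forall x, (1 <= p x)%E.
Context {I : choiceType} (Q : I -> set T).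
Hypothesis mQ : forall k, measurable (Q k).
Hypothesis Qoo : forall k, (mu (Q k) < +oo)%E.
Variable q : \bar R.
Hypothesis q1 : (1 <= q)%E.
Implicit Types (u w g : T -> R).

Local Notation piece u k := (luxemburg mu p (\1_(Q k) \* u)%R).

Definition mixed_norm u : \bar R := lqnorm q (fun k => piece u k).

Lemma mixed_normZ (c : R) u : 0 < c ->
  mixed_norm (fun x => c * u x) = (c%:E * mixed_norm u)%E.
Proof.
move=> c0; rewrite /mixed_norm -lqnormZ//; last by move=> k; exact: luxemburg_ge0.
congr lqnorm; apply/funext => k; rewrite -luxemburgZ//; congr luxemburg.
by apply/funext => x /=; rewrite mulrCA.
Qed.

(** Norming functions [g k] of the pieces, glued with the coefficients
    [b k ^ (r - 1)], pair with [w] to at most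
    sum_k (b k ^ (r - 1) * piece w k) <= (1 + (r - 1)) / r = 1
    by the tangent inequality, as both r-sums are at most 1, and with [u] to at
    least sum_k (b k ^ r) = 1.  The strict inequality [b k < piece u k] is what
    the local norming functions require. *)
Let norming_pieces (r : R) u (s : seq I) (b : I -> R) : 1 <= r -> q = r%:E ->
  uniq s -> nonneg_measurable u ->
  (forall k, 0 <= b k) -> (forall k, ((b k)%:E < piece u k)%E \/ b k = 0) ->
  \sum_(k <- s) b k `^ r = 1 ->
  exists g, [/\ nonneg_measurable g, (1 <= \int[mu]_x (g x * u x)%:E)%E &
    forall w, nonneg_measurable w -> (mixed_norm w <= 1)%E ->
      (\int[mu]_x (g x * w x)%:E <= 1)%E].
Proof.
move=> r1 qr us m_u b0 bu sb1.
have /choice[g gP] : forall k, exists g, [/\ nonneg_measurable g,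
    ((b k)%:E <= \int[mu]_x (g x * u x)%:E)%E &
    forall w, nonneg_measurable w -> (\int[mu]_x (g x * w x)%:E <= piece w k)%E].
  move=> k; have [bk0|bk0] := eqVneq (b k) 0.
    exists (cst 0); split; first exact: nonneg_measurable_cst.
      by rewrite bk0 integral_ge0// => x _; rewrite lee_fin mul0r.
    move=> w _; under eq_integral do rewrite mul0r.
    by rewrite integral0 luxemburg_ge0.
  apply: luxemburg_norming => //; first by rewrite lt_neqAle eq_sym bk0 b0.
  by case: (bu k) => // bk; rewrite bk eqxx in bk0.
pose c k := b k `^ (r - 1).
have mg k : nonneg_measurable (g k) by have [] := gP k.
have c0 k : 0 <= c k by exact: powR_ge0.
pose G x := \sum_(k <- s) c k * g k x.
have mG : nonneg_measurable G.
  split; last by move=> x; apply: sumr_ge0 => k _; rewrite mulr_ge0//; have [] := mg k.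
  apply: measurable_sum => k; apply: measurable_funM => //; by have [] := mg k.
have intG w : nonneg_measurable w -> (\int[mu]_x (G x * w x)%:E =
    \sum_(k <- s) ((c k)%:E * \int[mu]_x (g k x * w x)%:E))%E.
  move=> mw; have mgw k := nonneg_measurableM (mg k) mw.
  transitivity (\int[mu]_x \sum_(k <- s) ((c k)%:E * (g k x * w x)%:E))%E.
    apply: eq_integral => x _; rewrite /G mulr_suml -sumEFin.
    by apply: eq_bigr => k _; rewrite -mulrA EFinM.
  rewrite ge0_integral_sum//; last 2 first.
  - by move=> k; apply: emeasurable_funM => //; exact: measurable_EFin_fun (mgw k).
  - by move=> k x _; rewrite mule_ge0// lee_fin//; have [_] := mgw k; exact.
  apply: eq_bigr => k _; rewrite ge0_integralZl ?lee_fin//.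
  - exact: measurable_EFin_fun (mgw k).
  - by move=> x _; rewrite lee_fin; have [_] := mgw k; exact.
exists G; split => //.
  rewrite intG//; apply: (@le_trans _ _ (\sum_(k <- s) ((c k)%:E * (b k)%:E))%E).
    under eq_bigr do rewrite -EFinM; rewrite sumEFin lee_fin -sb1.
    apply: ler_sum => k _; rewrite /c.
    have [->|bk0] := eqVneq (b k) 0; first by rewrite mulr0 powR0// gt_eqF//; lra.
    rewrite -[X in _ * X]powRr1// -powRD ?subrK//.
    by rewrite bk0 implybT.
  apply: lee_sum => k _; apply: lee_wpmul2l; first by rewrite lee_fin.
  by have [] := gP k.
move=> w mw w1; rewrite intG//.
have /(lqnorm_le1 _ r1) w1' : (lqnorm r%:E (fun k => piece w k) <= 1)%E.
  by rewrite -qr.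
have wfin k : (piece w k \is a fin_num)%E.
  rewrite ge0_fin_numE ?luxemburg_ge0//; apply: le_lt_trans (ltry 1).
  by apply: le_trans w1; apply: (le_lqnorm k q1) => j; exact: luxemburg_ge0.
pose A k := fine (piece w k).
have A0 k : 0 <= A k by rewrite fine_ge0// luxemburg_ge0.
have sA : \sum_(k <- s) A k `^ r <= 1.
  rewrite -lee_fin; apply: le_trans w1'; apply: esum_ge; exists [set` s].
    by split => //; exact: finite_seq.
  rewrite -fsbig_seq// -sumEFin; apply: lee_sum => k _.
  by rewrite -poweR_EFin fineK.
apply: (@le_trans _ _ (\sum_(k <- s) (c k * A k))%:E).
  rewrite -sumEFin; apply: lee_sum => k _; rewrite EFinM lee_wpmul2l ?lee_fin//.
  by rewrite fineK//; have [_ _] := gP k; exact.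
rewrite lee_fin -(ler_pM2l (_ : 0 < r)); last lra.
rewrite mulr1 mulr_sumr.
apply: (@le_trans _ _ (\sum_(k <- s) (A k `^ r + (r - 1) * b k `^ r))).
  by apply: ler_sum => k _; rewrite mulrA; exact: powR_tangent.
by rewrite big_split /= -mulr_sumr sb1; lra.
Qed.

(** If one piece exceeds 1, its own norming function is enough; this settles
    [q = +oo].  Otherwise all pieces are finite, and finitely many of them have
    an r-sum [S > 1]. *)
Lemma mixed_norming u : nonneg_measurable u -> (1 < mixed_norm u)%E ->
  exists g, [/\ nonneg_measurable g, (1 <= \int[mu]_x (g x * u x)%:E)%E &
    forall w, nonneg_measurable w -> (mixed_norm w <= 1)%E ->
      (\int[mu]_x (g x * w x)%:E <= 1)%E].
Proof.
move=> m_u u1.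
have [[k k1]|/forallNP small] := pselect (exists k, 1 < piece u k)%E.
  have [g [mg gu gw]] := luxemburg_norming mp p1 m_u (mQ k) (Qoo k) ltr01 k1.
  exists g; split => // w mw w1; apply: le_trans (gw _ mw) (le_trans _ w1).
  by apply: (le_lqnorm k q1) => j; exact: luxemburg_ge0.
have le1 k : (piece u k <= 1)%E by rewrite leNgt; apply/negP/small.
have fin k : (piece u k \is a fin_num)%E.
  by rewrite ge0_fin_numE ?luxemburg_ge0// (le_lt_trans (le1 k))// ltry.
have [r qr] : exists r : R, q = r%:E.
  case Eq : q q1 => [r| |]// _; first by exists r.
  exfalso; move: u1; rewrite ltNge => /negP; apply.
  by rewrite /mixed_norm Eq /=; apply: ge_ereal_sup => _ [k _ <-].
have r1 : 1 <= r by move: q1; rewrite qr lee_fin.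
have r0 : 0 < r by lra.
have /ereal_sup_gt[_ [F [finF _] <-]] :
    (1 < \esum_(k in [set: I]) (piece u k `^ r))%E.
  rewrite ltNge; apply/negP => /(lqnorm_le1 _ r1).
  by rewrite leNgt -qr -/(mixed_norm u) u1.
rewrite fsbig_finite//=; set s := finmap.enum_fset _ => S1.
have us : uniq s by exact: finmap.fset_uniq.
pose a k := fine (piece u k).
have a0 k : 0 <= a k by rewrite fine_ge0// luxemburg_ge0.
have {}S1 : 1 < \sum_(k <- s) a k `^ r.
  rewrite -lte_fin -sumEFin; apply: lt_le_trans S1 _; apply: lee_sum => k _.
  by rewrite -poweR_EFin fineK.
set S := \sum_(k <- s) _ in S1.
(* Multiplication by theta < 1 brings the r-sum down to exactly 1 and puts the
   coefficients strictly below the pieces. *)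
pose theta := S `^ (- r^-1).
have S0 : 0 < S by lra.
have theta_lt1 : 0 < theta < 1.
  rewrite /theta powRN invr_gt0 powR_gt0//= invf_lt1 ?powR_gt0//.
  have one : 1 `^ r^-1 = 1 :> R by rewrite powR1.
  rewrite -[ltLHS]one; apply: gt0_ltr_powR; rewrite ?nnegrE ?invr_gt0//; lra.
have /andP[theta0 theta1] := theta_lt1.
apply: (@norming_pieces r u s (fun k => theta * a k)) => //.
- by move=> k; rewrite mulr_ge0// ltW.
- move=> k; have [ak0|ak0] := eqVneq (a k) 0; first by right; rewrite ak0 mulr0.
  left; rewrite -[ltRHS](fineK (fin k)) lte_fin gtr_pMl//.
  by rewrite lt_neqAle eq_sym ak0 a0.
under eq_bigr => k _ do rewrite powRM// ?(ltW theta0)//.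
rewrite -mulr_sumr -/S /theta -powRrM mulNr mulVf ?gt_eqF// powRN powRr1; last lra.
by rewrite mulVf// gt_eqF//; lra.
Qed.

End mixed.

(** * Fofana spaces and their Koethe biduals *)

Section concrete.
Context {R : realType} {d : nat}.
Local Notation V := 'rV[R]_d.+1.
Local Notation E := (Rn R d).
Local Notation normc := (@Normc.normc R).
Implicit Types (f g h : E -> R[i]).

Lemma normc_ge0 (z : R[i]) : 0 <= normc z.
Proof. by case: z => a b; exact: sqrtr_ge0. Qed.

Lemma normc_ge0_real (r : R) : 0 <= r -> normc r%:C%C = r.
Proof. by move=> r0; rewrite /= expr0n addr0 sqrtr_sqr ger0_norm. Qed.

Lemma nonneg_measurable_normc f : L0 f ->
  nonneg_measurable (fun x => normc (f x)).
Proof.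
move=> [mRe mIm]; split; last by move=> x; exact: normc_ge0.
have -> : (fun x => normc (f x)) =
    (fun x => Num.sqrt (complex.Re (f x) ^+ 2 + complex.Im (f x) ^+ 2)).
  by apply/funext => x; case: (f x).
apply: (@measurableT_comp _ _ _ _ _ _ (@Num.sqrt R)).
  by apply: continuous_measurable_fun; exact: sqrt_continuous.
by apply: measurable_funD; exact: measurable_funX.
Qed.

Lemma L0_real (u : E -> R) : measurable_fun [set: E] u -> L0 (fun x => (u x)%:C%C).
Proof. by move=> mu; split; [exact: mu|exact: measurable_cst]. Qed.

Lemma L0M_real (u : E -> R) f : measurable_fun [set: E] u -> L0 f ->
  L0 (fun x => (u x)%:C%C * f x).
Proof.
move=> mu [mRe mIm]; split.
- have -> : (fun x => complex.Re ((u x)%:C%C * f x)) = u \* (fun x => complex.Re (f x)).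
    by apply/funext => x /=; case: (f x) => a b /=; rewrite mul0r subr0.
  exact: measurable_funM.
- have -> : (fun x => complex.Im ((u x)%:C%C * f x)) = u \* (fun x => complex.Im (f x)).
    by apply/funext => x /=; case: (f x) => a b /=; rewrite mul0r addr0.
  exact: measurable_funM.
Qed.

Lemma cutoffE f (A : set E) : cutoff f A = fun x => (\1_A x : R)%:C%C * f x.
Proof.
by apply/funext => x; rewrite /cutoff mulrC !indicE; case: (x \in A); rewrite ?mul0r ?mul1r.
Qed.

Lemma L0_cutoff f (A : set E) : measurable A -> L0 f -> L0 (cutoff f A).
Proof.
by move=> mA L0f; rewrite cutoffE; apply: L0M_real L0f; exact: measurable_indic.
Qed.

Lemma pnorm_cutoff p f (A : set E) :
  pnorm p (cutoff f A) = luxemburg lebesgue p (\1_A \* (fun x => normc (f x))).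
Proof.
have -> : \1_A \* (fun x => normc (f x)) = (fun x => normc (cutoff f A x)).
  by apply/funext => x; rewrite cutoffE Normc.normcM normc_ge0_real// indicE.
by [].
Qed.

Lemma measurable_cube (k : 'rV[int]_d.+1) : measurable (cube 1 k : set E).
Proof.
rewrite (_ : cube 1 k = box (\row_j (k ord0 j)%:~R) (\row_j ((k ord0 j)%:~R + 1))).
  exact: measurable_box.
by apply/seteqP; split=> x kx j; have := kx j; rewrite !mxE !mul1r.
Qed.

Lemma lebesgue_cube_lty (k : 'rV[int]_d.+1) : (lebesgue (cube 1 k : set E) < +oo)%E.
Proof.
rewrite (_ : cube 1 k = box (\row_j (k ord0 j)%:~R) (\row_j ((k ord0 j)%:~R + 1))).
  by apply: lebesgue_box_lty => i; rewrite !mxE lerDl.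
by apply/seteqP; split=> x kx j; have := kx j; rewrite !mxE !mul1r.
Qed.

Lemma amalgam_normE p q f : amalgam_norm p q f =
  mixed_norm lebesgue p (fun k => cube 1 k : set E) q (fun x => normc (f x)).
Proof. by congr lqnorm; apply/funext => k; exact: pnorm_cutoff. Qed.

(** The cube containing [x] is indexed by the integer parts of the coordinates
    of [x], which take finitely many values on a bounded set. *)
Lemma compact_cube_cover (K : set V) : compact K ->
  exists s : seq 'rV[int]_d.+1, forall x, K x -> exists2 k, k \in s & cube 1 k x.
Proof.
move=> cK; have [M [_ /(_ (M + 1))]] := compact_bounded cK.
rewrite ltrDl ltr01 => /(_ isT) KM.
pose N := Num.bound (`|M| + 1).
have NM : M + 1 < N%:R.
  apply: le_lt_trans (archi_boundP _); last by rewrite addr_ge0.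
  by rewrite lerD2r ler_norm.
pose lattice (phi : {ffun 'I_d.+1 -> 'I_(N + N).+1}) : 'rV[int]_d.+1 :=
  \row_j ((phi j)%:Z - N%:Z).
exists [seq lattice phi | phi <- enum {: {ffun 'I_d.+1 -> 'I_(N + N).+1}}] => x Kx.
have xN j : `|x ord0 j| < N%:R.
  apply: le_lt_trans NM; apply: le_trans (KM x Kx).
  rewrite /Num.norm /= mx_normrE.
  by have := le_bigmax (0 : R) (fun i : 'I_1 * 'I_d.+1 => `|x i.1 i.2|) (ord0, j).
(* The integer parts lie between - N and N - 1; shifting them by N gives
   indices of an ordinal type. *)
pose n j : nat := absz (Num.floor (x ord0 j) + N%:Z).
have nE j : (n j)%:Z = Num.floor (x ord0 j) + N%:Z.
  rewrite /n gez0_abs// -lerBlDr sub0r -ltzD1 -(ltr_int R).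
  apply: le_lt_trans (proj2 (andP (floor_itv (x ord0 j)))).
  by have := xN j; rewrite ltr_norml rmorphN/= => /andP[/ltW].
have nN j : (n j < (N + N).+1)%N.
  rewrite -ltz_nat nE -[(N + N).+1]addn1 !PoszD.
  have : Num.floor (x ord0 j) < N%:Z.
    rewrite -(ltr_int R); apply: le_lt_trans (proj1 (andP (floor_itv (x ord0 j)))) _.
    by have := xN j; rewrite ltr_norml => /andP[].
  lra.
exists (lattice [ffun j => inord (n j)]).
  by apply: map_f; rewrite mem_enum.
move=> j; rewrite !mxE ffunE inordK// nE addrK !mul1r.
by have := floor_itv (x ord0 j); rewrite intrD.
Qed.

Lemma normc_dilate alpha (rho : R) f x : normc (dilate alpha rho f x) =
  rho `^ (- (d.+1%:R * fine (alpha^-1)%E)) * normc (f (rho^-1 *: (x : V))).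
Proof. by rewrite Normc.normcM normc_ge0_real// powR_ge0. Qed.

Lemma L0_dilate alpha (rho : R) f : 0 < rho -> L0 f -> L0 (dilate alpha rho f).
Proof.
move=> rho0 [mRe mIm]; apply: (@L0M_real (fun=> _)); first exact: measurable_cst.
have ms := @measurable_scale R d rho^-1; rewrite invr_gt0 in ms.
by split; [exact: measurableT_comp mRe (ms rho0)|exact: measurableT_comp mIm (ms rho0)].
Qed.

Lemma dilate1 alpha f : dilate alpha 1 f = f.
Proof.
by apply/funext => x; rewrite /dilate powR1 invr1 scale1r mul1r.
Qed.

Lemma dilateM alpha rho (c : R) f :
  dilate alpha rho (fun x => c%:C%C * f x) = fun x => c%:C%C * dilate alpha rho f x.
Proof. by apply/funext => x; rewrite /dilate mulrCA. Qed.

Variables (p : E -> \bar R) (q alpha : \bar R).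
Hypothesis p_exponent : variable_exponent p.
Hypothesis q1 : (1 <= q)%E.

Let mp : measurable_fun [set: E] p. Proof. by have [] := p_exponent. Qed.
Let p1 x : (1 <= p x)%E. Proof. by have [_] := p_exponent; exact. Qed.

Lemma amalgam_normZ (c : R) f : 0 < c ->
  amalgam_norm p q (fun x => c%:C%C * f x) = (c%:E * amalgam_norm p q f)%E.
Proof.
move=> c0; rewrite [LHS]amalgam_normE [in RHS]amalgam_normE.
have -> : (fun x => normc (c%:C%C * f x)) = (fun x => c * normc (f x)).
  by apply/funext => x; rewrite Normc.normcM normc_ge0_real// ltW.
exact: mixed_normZ.
Qed.

Lemma fofana_normZ (c : R) f : 0 < c ->
  fofana_norm p q alpha (fun x => c%:C%C * f x) = (c%:E * fofana_norm p q alpha f)%E.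
Proof.
move=> c0; rewrite /fofana_norm -ereal_sup_pZl// image_comp; congr ereal_sup.
by apply: eq_imagel => rho _; rewrite dilateM amalgam_normZ.
Qed.

(** A finite norm forces local membership: [rho = 1] bounds the norm on every
    unit cube, and finitely many unit cubes cover a compact set. *)
Lemma fofana_carrierP f : carrier (fofana p q alpha) f <->
  L0 f /\ (fofana_norm p q alpha f < +oo)%E.
Proof.
split=> [[[L0f _] foo]|[L0f foo]]; first exact: conj L0f foo.
split; last exact: foo.
split=> [|K cK]; first exact: L0f.
have mK : measurable (K : set E) by exact: measurable_compact.
split; first exact: L0_cutoff.
have mf := nonneg_measurable_normc L0f.
rewrite pnorm_cutoff; have [s sK] := compact_cube_cover cK.
apply: (luxemburg_cover mp p1 measurable_cube mf mK sK) => k.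
apply: le_lt_trans foo; apply: (@le_trans _ _ (amalgam_norm p q f)).
  rewrite amalgam_normE.
  by apply: (@le_lqnorm _ _ q _ k q1) => j; exact: luxemburg_ge0.
by apply: ereal_sup_ubound; exists 1; [exact: ltr01|rewrite dilate1].
Qed.

(** A norming function [g0] of the dilate of [f] is carried back by the change of
    variables [x = rho y]; the factor of [g] is the Jacobian times the constant
    of the dilation, and the pairing is unchanged. *)
Lemma dilate_norming rho (c : R) f : L0 f -> 0 < rho -> 0 < c ->
  (c%:E < amalgam_norm p q (dilate alpha rho f))%E ->
  exists g : E -> R, [/\ nonneg_measurable g,
    (c%:E <= \int[lebesgue]_x (g x * normc (f x))%:E)%E &
    forall h, L0 h -> (amalgam_norm p q (dilate alpha rho h) <= 1)%E ->
      (\int[lebesgue]_x (g x * normc (h x))%:E <= 1)%E].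
Proof.
move=> L0f rho0 c0 cf; have ci0 : 0 < c^-1 by rewrite invr_gt0.
have mD h : L0 h -> nonneg_measurable (fun x => normc (dilate alpha rho h x)).
  by move=> L0h; apply: nonneg_measurable_normc; exact: L0_dilate.
have [] := @mixed_norming _ _ _ lebesgue p mp p1 _ (fun k => cube 1 k : set E)
  measurable_cube lebesgue_cube_lty q q1 (fun x => c^-1 * normc (dilate alpha rho f x)).
- by apply: nonneg_measurableZ (mD _ L0f); exact: ltW.
- by rewrite mixed_normZ// -amalgam_normE lte_pdivlMl// mule1.
move=> g0 [mg0 g0f g0w].
pose kappa := rho `^ (- (d.+1%:R * fine (alpha^-1)%E)).
have kappa0 : 0 <= kappa by exact: powR_ge0.
have rn0 : 0 < rho ^+ d.+1 by rewrite exprn_gt0.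
pose g (y : E) : R := rho ^+ d.+1 * kappa * g0 (rho *: (y : V)).
have mg : nonneg_measurable g.
  apply: nonneg_measurableZ; first by rewrite mulr_ge0// ltW.
  split; last by move=> x; have [_] := mg0; exact.
  by apply: measurableT_comp (measurable_scale rho0); have [] := mg0.
have intE h : L0 h -> (\int[lebesgue]_x (g x * normc (h x))%:E =
    \int[lebesgue]_x (g0 x * normc (dilate alpha rho h x))%:E)%E.
  move=> L0h; have mF := nonneg_measurableM mg0 (mD _ L0h).
  pose F (x : E) := (g0 x * normc (dilate alpha rho h x))%:E.
  have mFE : measurable_fun [set: E] F by exact: measurable_EFin_fun mF.
  have F0 x : (0 <= F x)%E by rewrite lee_fin; have [_] := mF; exact.
  have := integral_scale rho0 mFE F0.
  move=> /(congr1 (fun z => (rho ^+ d.+1)%:E * z)%E).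
  rewrite muleA -EFinM divff ?gt_eqF// mul1e => <-.
  rewrite -ge0_integralZl.
  - apply: eq_integral => x _; rewrite /F normc_dilate -EFinM /g; congr (_%:E).
    by rewrite scalerA mulVf ?gt_eqF// scale1r -/kappa -!mulrA; congr (_ * _);
      rewrite mulrCA.
  - exact: measurableT.
  - exact: measurableT_comp mFE (measurable_scale rho0).
  - by move=> x _; exact: F0.
  - by rewrite lee_fin ltW.
exists g; split => //; last first.
  move=> h L0h h1; rewrite intE//; apply: g0w; first exact: mD.
  by rewrite -amalgam_normE.
rewrite intE//; move: g0f; rewrite (integralM_scale _ (ltW ci0) mg0 (mD _ L0f)).
by rewrite lee_pdivlMl// mule1.
Qed.

Local Notation X := (fofana p q alpha).

(** The definition of the dual norm gives the bound on the unit ball; for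
    [||f|| = N] it is applied to [f / (N + e)], which also covers [N = 0]. *)
Lemma kothe_norm_le g f : carrier X f -> L0 g -> (kothe_norm X g <= 1)%E ->
  (\int[lebesgue]_x (normc (f x * g x))%:E <= fofana_norm p q alpha f)%E.
Proof.
move=> /fofana_carrierP[L0f foo] L0g g1.
have fge0 : (0 <= fofana_norm p q alpha f)%E.
  apply: (@le_trans _ _ (amalgam_norm p q f)).
    rewrite amalgam_normE; apply: le_trans (le_lqnorm 0 q1 _).
      exact: luxemburg_ge0.
    by move=> k; exact: luxemburg_ge0.
  by apply: ereal_sup_ubound; exists 1; [exact: ltr01|rewrite dilate1].
have [N N0 NE] : exists2 N : R, 0 <= N & fofana_norm p q alpha f = N%:E.
  exists (fine (fofana_norm p q alpha f)); first exact: fine_ge0.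
  by rewrite fineK// ge0_fin_numE.
rewrite NE; apply/lee_addgt0Pr => e e0; rewrite -EFinD.
have Ne : 0 < N + e by rewrite ltr_wpDl.
have Nei : 0 < (N + e)^-1 by rewrite invr_gt0.
pose f' x := (N + e)^-1%:C%C * f x.
have f'1 : (fofana_norm p q alpha f' <= 1)%E.
  by rewrite fofana_normZ// NE lee_pdivrMl// mule1 lee_fin lerDl ltW.
have f'X : carrier X f'.
  apply/fofana_carrierP; split; last exact: le_lt_trans f'1 (ltry 1).
  by apply: (@L0M_real (fun=> _)) L0f; exact: measurable_cst.
have : (\int[lebesgue]_x (normc (g x * f' x))%:E <= 1)%E.
  by apply: le_trans g1; apply: ereal_sup_ubound; exists f'.
have -> : (fun x => (normc (g x * f' x))%:E) =
    (fun x => (normc (g x) * ((N + e)^-1 * normc (f x)))%:E).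
  by apply/funext => x; rewrite !Normc.normcM normc_ge0_real// ltW.
rewrite (integralM_scale _ (ltW Nei) (nonneg_measurable_normc L0g)
  (nonneg_measurable_normc L0f)).
rewrite lee_pdivrMl// mule1; apply: le_trans; rewrite le_eqVlt; apply/predU1P; left.
by apply: eq_integral => x _; rewrite Normc.normcM mulrC.
Qed.

(** A norming function for one dilation is in the unit ball of the Koethe dual,
    because the norm of the space dominates the norm at each dilation. *)
Lemma kothe_bidual_ge f : L0 f ->
  (fofana_norm p q alpha f <= kothe_norm (kothe_dual X) f)%E.
Proof.
move=> L0f; apply: ge_ereal_sup => _ [rho /= rho0 <-].
have dual_ge0 : (0 <= kothe_norm (kothe_dual X) f)%E.
  pose z : E -> R[i] := fun=> 0.
  have z0 : (kothe_norm X z <= 0)%E.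
    apply: ge_ereal_sup => _ [h _ <-].
    by under eq_integral do rewrite mul0r Normc.normc0; rewrite integral0.
  apply: ereal_sup_ubound; exists z.
    split; last exact: le_trans z0 lee01.
    split; last exact: le_lt_trans z0 (ltry 0).
    exact: (@L0_real (fun=> 0) (measurable_cst _)).
  by under eq_integral do rewrite mulr0 Normc.normc0; rewrite integral0.
rewrite leNgt; apply/negP => NA.
have [c c0 /andP[Nc cA]] : exists2 c : R, 0 < c & (kothe_norm (kothe_dual X) f <
    c%:E < amalgam_norm p q (dilate alpha rho f))%E.
  move: dual_ge0 NA; case: (kothe_norm _ f) => [N| |]//; last by move=> _; rewrite ltNge leey.
  rewrite lee_fin; case: (amalgam_norm _ _ _) => [A| |]// N0.
    rewrite lte_fin => NA; exists ((N + A) / 2); first lra.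
    by rewrite !lte_fin; apply/andP; split; lra.
  by move=> _; exists (N + 1); [lra|rewrite lte_fin ltry andbT; lra].
have [g [mg gf gX]] := dilate_norming L0f rho0 c0 cA.
have L0g : L0 (fun x => (g x)%:C%C) by apply: L0_real; case: mg.
have normg h x : normc ((g x)%:C%C * h x) = g x * normc (h x).
  by rewrite Normc.normcM normc_ge0_real//; case: mg => _; exact.
have g1 : (kothe_norm X (fun x => (g x)%:C%C) <= 1)%E.
  apply: ge_ereal_sup => _ [h [/fofana_carrierP[L0h _] h1] <-].
  under eq_integral do rewrite normg.
  apply: gX L0h _; apply: le_trans h1; apply: ereal_sup_ubound.
  by exists rho.
suff : (c%:E <= kothe_norm (kothe_dual X) f)%E by rewrite leNgt Nc.
apply: le_trans gf _; apply: ereal_sup_ubound; exists (fun x => (g x)%:C%C).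
  split; last exact: g1.
  by split; [exact: L0g|exact: le_lt_trans g1 (ltry 1)].
by apply: eq_integral => x _; rewrite mulrC normg.
Qed.

End concrete.

Local Open Scope ereal_scope.

Theorem corollary5p1 (R : realType) (d : nat)
    (p : Rn R d -> \bar R) (alpha q : \bar R)
    (p_exponent : variable_exponent p)
    (p_le_alpha : forall x, p x <= alpha)
    (alpha_le_q : alpha <= q) :
  coincide (fofana p q alpha) (kothe_bidual (fofana p q alpha)).
Proof.
have q1 : 1 <= q.
  have [_ /(_ point) p1] := p_exponent.
  exact: le_trans p1 (le_trans (p_le_alpha _) alpha_le_q).
have normE f : carrier (fofana p q alpha) f ->
    fofana_norm p q alpha f = kothe_norm (kothe_dual (fofana p q alpha)) f.
  move=> Xf; apply/eqP; rewrite eq_le; apply/andP; split.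
    have /(fofana_carrierP _ p_exponent q1)[L0f _] := Xf.
    exact: (kothe_bidual_ge _ p_exponent q1 L0f).
  apply: ge_ereal_sup => _ [g [[L0g _] g1] <-].
  exact: kothe_norm_le.
split; last exact: normE.
apply/seteqP; split=> f Xf.
  have /(fofana_carrierP _ p_exponent q1)[L0f foo] := Xf.
  by split; [exact: L0f|rewrite /= -normE].
have [L0f foo] := Xf; apply/(fofana_carrierP _ p_exponent q1); split => //.
exact: le_lt_trans (kothe_bidual_ge _ p_exponent q1 L0f) foo.
Qed.
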